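(* Let $C \in \mathrm{CGA}_+[t]$ be a monic motion polynomial of degree two with a factorization $C = (t-h_1)(t-h_2)$, where $h_1,h_2\in \mathrm{CGA}_+$ and $t-h_1$, $t-h_2$ are motion polynomials. Then this factorization is irregular if and only if $h_1-\tilde{h}_2$ is not invertible.
   Context: $\mathrm{CGA}$ (conformal geometric algebra) is the real Clifford algebra of signature $(4,1)$ with orthonormal generators $e_1,e_2,e_3,e_+,e_-$ satisfying $e_1^2=e_2^2=e_3^2=e_+^2=1$, $e_-^2=-1$ and $e_ie_j=-e_je_i$ for $i\neq j$. Products of generators are written $e_{ij}=e_ie_j$, etc. $\mathrm{CGA}_+$ is its even subalgebra. Reversion $a\mapsto\tilde a$ is the linear anti-automorphism that reverses the order of products of generators. The real numbers are identified with the scalars of the algebra. Polynomials in $\mathrm{CGA}_+[t]$ have an indeterminate $t$ that commutes with all coefficients. The reversion $\tilde C$ of $C\in\mathrm{CGA}_+[t]$ is obtained by reversing all coefficients. $C$ is called a motion polynomial if $C\tilde C=\tilde C C\in\mathbb{R}[t]\setminus\{0\}$. In particular, for $h\in\mathrm{CGA}_+$, the polynomial $t-h$ is a motion polynomial if and only if $h+\tilde h\in\mathbb{R}$ and $h\tilde h\in\mathbb{R}$. For a monic quadratic $M\in\mathbb{R}[t]$, each $P\in \mathrm{CGA}_+[t]$ can be written uniquely as $P=QM+R$ with $R=r_1t+r_0$, $r_0,r_1\in\mathrm{CGA}_+$. Here $R$ is the linear remainder polynomial, and its leading coefficient means the coefficient $r_1$ of $t$ (possibly zero, in which case it is non-invertible).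 A factorization $C=(t-h_1)(t-h_2)\cdots(t-h_n)$ of a motion polynomial $C$ (with each $t-h_i$ a motion polynomial) is called irregular if there exists an index $\ell\in\{1,\dots,n\}$ such that the linear remainder polynomial $R$ obtained by dividing either $(t-h_1)(t-h_2)\cdots(t-h_\ell)$ or $(t-h_\ell)(t-h_{\ell+1})\cdots(t-h_n)$ by $M:=(t-h_\ell)(t-\tilde h_\ell)$ has a non-invertible leading coefficient. *)

(* Defs.v *)
From HB Require Import structures.
From mathcomp Require Import all_boot all_order all_algebra.
From mathcomp Require Import reals ring.

Set Implicit Arguments.
Unset Strict Implicit.
Unset Printing Implicit Defensive.

Import GRing.Theory.
Local Open Scope ring_scope.

Definition symdiff n (A B : {set 'I_n}) : {set 'I_n} := (A :\: B) :|: (B :\: A).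

(* The sign produced by moving the generators indexed by [B] to the left past
   the larger ones indexed by [A]. *)
Definition reorder_sign (R : comNzRingType) n (A B : {set 'I_n}) : R :=
  \prod_(i in A) \prod_(j in B | (j < i)%N) (-1).

(* With e_A the product of the e_i, i in A, in increasing order and
   e_i * e_i = q i, one has e_A * e_B = blade_coef q A B e_(A symdiff B). *)
Definition blade_coef (R : comNzRingType) n (q : 'I_n -> R) (A B : {set 'I_n}) : R :=
  reorder_sign R A B * \prod_(i in A :&: B) q i.

(* The Clifford algebra of the diagonal form q: [x A] is the coordinate of x on
   the basis element e_A. *)
Definition clifford (R : comNzRingType) n (q : 'I_n -> R) : Type :=
  {ffun {set 'I_n} -> R}.

HB.instance Definition _ (R : comNzRingType) n (q : 'I_n -> R) :=
  GRing.Lmodule.copy (clifford q) {ffun {set 'I_n} -> R^o}.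

Section CliffordAlgebra.
Variables (R : comNzRingType) (n : nat) (q : 'I_n -> R).
Implicit Types (A B C D : {set 'I_n}) (i j : 'I_n) (x y z : clifford q).
Local Notation Cl := (clifford q).
Local Notation "A +^ B" := (symdiff A B) (at level 50, left associativity).

Definition cl_blade A : Cl := [ffun B => (B == A)%:R].

Definition cl_gen i : Cl := cl_blade [set i].

Definition cl_mul x y : Cl :=
  \sum_A \sum_B (x A * y B * blade_coef q A B) *: cl_blade (A +^ B).

Lemma in_symdiff A B i : (i \in A +^ B) = (i \in A) (+) (i \in B).
Proof. by rewrite !inE; case: (i \in A); case: (i \in B). Qed.

Lemma symdiffA A B C : A +^ (B +^ C) = A +^ B +^ C.
Proof. by apply/setP=> i; rewrite !in_symdiff addbA. Qed.

Lemma symdiffC A B : A +^ B = B +^ A.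
Proof. by apply/setP=> i; rewrite !in_symdiff addbC. Qed.

Lemma symdiffK A : involutive (symdiff A).
Proof. by move=> B; apply/setP=> i; rewrite !in_symdiff addKb. Qed.

Lemma symdiff0 A : A +^ set0 = A.
Proof. by apply/setP=> i; rewrite in_symdiff inE addbF. Qed.

Lemma symdiffv A : A +^ A = set0.
Proof. by apply/setP=> i; rewrite in_symdiff inE addbb. Qed.

Lemma symdiff_eq A B D : (A +^ B == D) = (B == A +^ D).
Proof. by apply/eqP/eqP=> [<-|->]; rewrite symdiffK. Qed.

Lemma odd_symdiff A B : odd #|A +^ B| = odd #|A| (+) odd #|B|.
Proof.
have dis : (A :\: B) :&: (B :\: A) = set0.
  by apply/setP=> i; rewrite !inE; case: (i \in A); case: (i \in B).
rewrite /symdiff cardsU dis cards0 subn0 oddD.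
rewrite -(cardsID B A) -(cardsID A B) !oddD setIC.
by do 3!case: (odd _).
Qed.

Lemma cl_eqP x y : (forall A, x A = y A) -> x = y.
Proof. by move=> e; apply/ffunP. Qed.

Lemma cl_addE x y A : (x + y) A = x A + y A. Proof. exact: ffunE. Qed.
Lemma cl_oppE x A : (- x) A = - x A. Proof. exact: ffunE. Qed.
Lemma cl_zeroE A : (0 : Cl) A = 0. Proof. exact: ffunE. Qed.
Lemma cl_scaleE (a : R) x A : (a *: x) A = a * x A. Proof. exact: ffunE. Qed.

Lemma cl_sumE (I : Type) (r : seq I) (P : pred I) (F : I -> Cl) A :
  (\sum_(i <- r | P i) F i) A = \sum_(i <- r | P i) F i A.
Proof.
by apply: (big_morph (fun x : Cl => x A)) => [x y|]; rewrite ?cl_addE ?cl_zeroE.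
Qed.

Lemma cl_bladeE A B : cl_blade A B = (B == A)%:R. Proof. exact: ffunE. Qed.

Lemma cl_mulE x y D :
  cl_mul x y D = \sum_A x A * y (A +^ D) * blade_coef q A (A +^ D).
Proof.
rewrite cl_sumE; apply: eq_bigr => A _; rewrite cl_sumE (bigD1 (A +^ D)) //=.
rewrite cl_scaleE cl_bladeE symdiffK eqxx mulr1 big1 ?addr0 // => B neB.
by rewrite cl_scaleE cl_bladeE eq_sym symdiff_eq (negPf neB) mulr0.
Qed.

Lemma reorder_signE A B : reorder_sign R A B =
  \prod_i \prod_j (if [&& i \in A, j \in B & (j < i)%N] then -1 else 1).
Proof.
rewrite /reorder_sign big_mkcond; apply: eq_bigr => i _.
by case: (i \in A) => /=; [rewrite big_mkcond | rewrite big1].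
Qed.

Lemma reorder_sign_symdiffl A B C :
  reorder_sign R (A +^ B) C = reorder_sign R A C * reorder_sign R B C.
Proof.
rewrite !reorder_signE -big_split; apply: eq_bigr => i _ /=.
rewrite -big_split; apply: eq_bigr => j _ /=; rewrite in_symdiff.
by do 3!case: (_ \in _); case: (_ < _)%N => /=; rewrite ?mulrNN ?mulr1 ?mul1r.
Qed.

Lemma reorder_sign_symdiffr A B C :
  reorder_sign R A (B +^ C) = reorder_sign R A B * reorder_sign R A C.
Proof.
rewrite !reorder_signE -big_split; apply: eq_bigr => i _ /=.
rewrite -big_split; apply: eq_bigr => j _ /=; rewrite in_symdiff.
by do 3!case: (_ \in _); case: (_ < _)%N => /=; rewrite ?mulrNN ?mulr1 ?mul1r.
Qed.

Lemma reorder_sign_sqr A B : reorder_sign R A B * reorder_sign R A B = 1.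
Proof.
rewrite -reorder_sign_symdiffr reorder_signE.
rewrite big1 // => i _; rewrite big1 // => j _.
by rewrite in_symdiff addbb /= andbF.
Qed.

Lemma blade_coef_cocycle A B C :
  blade_coef q A (B +^ C) * blade_coef q B C =
  blade_coef q (A +^ B) C * blade_coef q A B.
Proof.
rewrite /blade_coef reorder_sign_symdiffl reorder_sign_symdiffr.
rewrite mulrACA [RHS]mulrACA; congr (_ * _).
  by rewrite -mulrA [RHS]mulrC mulrA.
rewrite !(big_mkcond (fun i => i \in _ :&: _)) -!big_split /=.
apply: eq_bigr => i _; rewrite !in_setI !in_symdiff.
by do 3!case: (_ \in _); rewrite /= ?mulr1 ?mul1r.
Qed.

Lemma blade_coef0l A : blade_coef q set0 A = 1.
Proof. by rewrite /blade_coef /reorder_sign set0I !big_set0 mulr1. Qed.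

Lemma blade_coef0r A : blade_coef q A set0 = 1.
Proof.
rewrite /blade_coef /reorder_sign setI0 big_set0 mulr1 big1 // => i _.
by rewrite big1 // => j; rewrite inE.
Qed.

Fact cl_mulA : associative cl_mul.
Proof.
move=> x y z; apply: cl_eqP => D; rewrite !cl_mulE.
under eq_bigr => A _ do rewrite cl_mulE mulr_sumr mulr_suml.
under [RHS]eq_bigr => A _ do rewrite cl_mulE mulr_suml mulr_suml.
rewrite [RHS]exchange_big /=; apply: eq_bigr => A _.
rewrite [RHS](reindex_inj (inv_inj (symdiffK A))) /=; apply: eq_bigr => B _.
rewrite symdiffK; have -> : B +^ (A +^ D) = A +^ B +^ D.
  by rewrite symdiffA [B +^ A]symdiffC.
set C := A +^ B +^ D.
have -> : A +^ D = B +^ C by rewrite /C [A +^ B]symdiffC -symdiffA symdiffK.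
have := blade_coef_cocycle A B C; rewrite -/C.
set c1 := blade_coef _ _ _; set c2 := blade_coef _ _ _.
set c3 := blade_coef _ _ _; set c4 := blade_coef _ _ _ => e.
transitivity (x A * y B * z C * (c1 * c2)); first by ring.
by rewrite e; ring.
Qed.

Fact cl_mul1l : left_id (cl_blade set0) cl_mul.
Proof.
move=> x; apply: cl_eqP => D; rewrite cl_mulE (bigD1 set0) //= big1 => [|A neA].
  by rewrite cl_bladeE eqxx mul1r symdiffC symdiff0 blade_coef0l mulr1 addr0.
by rewrite cl_bladeE (negPf neA) !mul0r.
Qed.

Fact cl_mul1r : right_id (cl_blade set0) cl_mul.
Proof.
move=> x; apply: cl_eqP => D; rewrite cl_mulE (bigD1 D) //= big1 => [|A neA].
  by rewrite symdiffv cl_bladeE eqxx blade_coef0r !mulr1 addr0.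
by rewrite cl_bladeE symdiff_eq symdiff0 eq_sym (negPf neA) mulr0 mul0r.
Qed.

Fact cl_mulDl : left_distributive cl_mul +%R.
Proof.
move=> x y z; apply: cl_eqP => D; rewrite cl_addE !cl_mulE -big_split /=.
by apply: eq_bigr => A _; rewrite cl_addE !mulrDl.
Qed.

Fact cl_mulDr : right_distributive cl_mul +%R.
Proof.
move=> x y z; apply: cl_eqP => D; rewrite cl_addE !cl_mulE -big_split /=.
by apply: eq_bigr => A _; rewrite cl_addE mulrDr mulrDl.
Qed.

Fact cl_one_neq0 : cl_blade set0 != 0.
Proof.
by apply/eqP=> /ffunP/(_ set0)/eqP; rewrite cl_bladeE cl_zeroE eqxx oner_eq0.
Qed.

HB.instance Definition _ := GRing.Zmodule_isNzRing.Build Cl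
  cl_mulA cl_mul1l cl_mul1r cl_mulDl cl_mulDr cl_one_neq0.

Fact cl_scaleAl (a : R) x y : a *: (x * y) = (a *: x) * y.
Proof.
apply: cl_eqP => D; rewrite cl_scaleE !cl_mulE mulr_sumr.
by apply: eq_bigr => A _; rewrite cl_scaleE !mulrA.
Qed.

HB.instance Definition _ := GRing.Lmodule_isLalgebra.Build R Cl cl_scaleAl.

Fact cl_scaleAr (a : R) x y : a *: (x * y) = x * (a *: y).
Proof.
apply: cl_eqP => D; rewrite cl_scaleE !cl_mulE mulr_sumr.
by apply: eq_bigr => A _; rewrite cl_scaleE !mulrA [a * _]mulrC.
Qed.

HB.instance Definition _ := GRing.Lalgebra_isAlgebra.Build R Cl cl_scaleAr.

Lemma cl_coordE x : x = \sum_A x A *: cl_blade A.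
Proof.
apply: cl_eqP => B; rewrite cl_sumE (bigD1 B) //= big1 => [|A neA].
  by rewrite cl_scaleE cl_bladeE eqxx mulr1 addr0.
by rewrite cl_scaleE cl_bladeE eq_sym (negPf neA) mulr0.
Qed.

Lemma cl_bladeM A B :
  cl_blade A * cl_blade B = blade_coef q A B *: cl_blade (A +^ B).
Proof.
apply: cl_eqP => D; rewrite cl_scaleE cl_mulE (bigD1 A) //= big1 => [|C neC].
  rewrite !cl_bladeE eqxx mul1r addr0 symdiff_eq.
  by case: eqP => [->|_] /=; [rewrite symdiffK mul1r mulr1 | rewrite mul0r mulr0].
by rewrite cl_bladeE (negPf neC) !mul0r.
Qed.

Lemma reorder_sign1 i j : reorder_sign R [set i] [set j] = (-1) ^+ (j < i)%N.
Proof.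
rewrite /reorder_sign big_set1 big_mkcondr big_set1.
by case: (j < i)%N.
Qed.

Lemma cl_gen_sqr i : cl_gen i * cl_gen i = (q i)%:A.
Proof.
rewrite cl_bladeM /blade_coef reorder_sign1 ltnn mul1r setIid big_set1.
by rewrite symdiffv.
Qed.

Lemma cl_gen_anticomm i j : i != j -> cl_gen i * cl_gen j = - (cl_gen j * cl_gen i).
Proof.
move=> neij; rewrite !cl_bladeM symdiffC -scaleNr; congr (_ *: _).
rewrite /blade_coef setIC !reorder_sign1 -mulNr; congr (_ * _).
by case: ltngtP neij => [||/val_inj->]; rewrite ?eqxx ?opprK.
Qed.

Lemma cl_blade_prod A : cl_blade A = \prod_(i <- enum A) cl_gen i.
Proof.
suff H (s : seq 'I_n) : sorted ltn (map val s) ->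
    \prod_(i <- s) cl_gen i = cl_blade [set i in s].
  rewrite H; first by congr cl_blade; apply/setP=> i; rewrite inE mem_enum.
  apply: (subseq_sorted ltn_trans _ (iota_ltn_sorted 0 n)).
  by rewrite -val_enum_ord map_subseq // enumT filter_subseq.
elim: s => [|i s IH] /=.
  by rewrite big_nil => _; congr cl_blade; apply/setP=> i; rewrite !inE.
rewrite (path_sortedE ltn_trans) => /andP[/allP lt_is /IH {}IH].
have nis : i \notin s by apply/negP=> /(map_f val)/lt_is /=; rewrite ltnn.
rewrite big_cons IH cl_bladeM.
have -> : [set i] +^ [set j in s] = [set j in i :: s].
  apply/setP=> j; rewrite in_symdiff !inE.
  by case: eqP => // ->; rewrite (negPf nis).
rewrite /blade_coef /reorder_sign big_set1 big1 => [|j /andP[]]; last first.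
  by rewrite inE => /(map_f val)/lt_is/= lij; rewrite ltnNge ltnW.
rewrite big_pred0 ?mulr1 ?scale1r // => j; rewrite !inE.
by case: eqP => // ->; rewrite (negPf nis).
Qed.

(* Reversing a product of distinct anticommuting generators interchanges each
   pair of them once. *)
Definition cl_rev x : Cl := [ffun A => reorder_sign R A A * x A].

Lemma cl_revE x A : cl_rev x A = reorder_sign R A A * x A.
Proof. exact: ffunE. Qed.

Lemma cl_rev_linear (a : R) x y : cl_rev (a *: x + y) = a *: cl_rev x + cl_rev y.
Proof.
apply: cl_eqP => A; rewrite !(cl_revE, cl_addE, cl_scaleE) mulrDr.
by rewrite mulrCA.
Qed.

Lemma cl_rev_gen i : cl_rev (cl_gen i) = cl_gen i.
Proof.
apply: cl_eqP => A; rewrite cl_revE cl_bladeE.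
by case: eqP => [->|_]; rewrite ?mulr0 // reorder_sign1 ltnn mulr1.
Qed.

Lemma cl_rev1 : cl_rev 1 = 1.
Proof.
apply: cl_eqP => A; rewrite cl_revE cl_bladeE.
case: eqP => [->|_]; rewrite ?mulr0 // mulr1.
by rewrite /reorder_sign big_set0.
Qed.

Lemma cl_revK : involutive cl_rev.
Proof.
by move=> x; apply: cl_eqP => A; rewrite !cl_revE mulrA reorder_sign_sqr mul1r.
Qed.

Lemma cl_revM x y : cl_rev (x * y) = cl_rev y * cl_rev x.
Proof.
apply: cl_eqP => D; rewrite cl_revE !cl_mulE mulr_sumr.
rewrite (reindex_inj (inv_inj (fun A => symdiffK D A))) /=.
apply: eq_bigr => B _; rewrite [D +^ B]symdiffC; set A := B +^ D.
have eD : D = A +^ B by rewrite symdiffC symdiffK.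
clearbody A.
have -> : A +^ D = B by rewrite eD symdiffK.
rewrite !cl_revE eD.
rewrite /blade_coef !reorder_sign_symdiffl !reorder_sign_symdiffr [B :&: A]setIC.
set p := \prod_(_ in _) _.
have := reorder_sign_sqr A B.
set a := reorder_sign R A A; set b := reorder_sign R B B.
set c := reorder_sign R A B; set d := reorder_sign R B A => cc.
transitivity ((c * c) * (a * b * d * x A * y B * p)); first by ring.
by rewrite cc; ring.
Qed.

Definition cl_even : {pred Cl} := fun x => [forall A : {set 'I_n}, odd #|A| ==> (x A == 0)].

Lemma cl_evenP x : reflect (forall A, odd #|A| -> x A = 0) (x \in cl_even).
Proof.
apply: (iffP forallP) => ev A; first by move=> oA; apply/eqP/(implyP (ev A)).
by apply/implyP=> oA; rewrite ev.
Qed.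

Fact cl_even_subalg : subalg_closed cl_even.
Proof.
split=> [|a x y|x y].
- by apply/cl_evenP=> A oA; rewrite cl_bladeE; case: eqP oA => // ->; rewrite cards0.
- move=> /cl_evenP ex /cl_evenP ey; apply/cl_evenP=> A oA.
  by rewrite cl_addE cl_scaleE ex // ey // mulr0 addr0.
move=> /cl_evenP ex /cl_evenP ey; apply/cl_evenP=> D oD.
rewrite cl_mulE big1 // => A _; case oA: (odd #|A|); first by rewrite ex // !mul0r.
by rewrite ey ?mulr0 ?mul0r // odd_symdiff oA oD.
Qed.

HB.instance Definition _ := GRing.isSubalgClosed.Build R Cl cl_even cl_even_subalg.

Fact cl_rev_even x : x \in cl_even -> cl_rev x \in cl_even.
Proof. by move=> /cl_evenP ex; apply/cl_evenP=> A oA; rewrite cl_revE ex // mulr0. Qed.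

Record even_clifford := EvenClifford {
  even_val :> Cl;
  even_valP : even_val \in cl_even
}.

HB.instance Definition _ := [isSub for even_val].
HB.instance Definition _ := [Choice of even_clifford by <:].
HB.instance Definition _ :=
  [SubChoice_isSubAlgebra of even_clifford by <:].

Definition even_rev (x : even_clifford) : even_clifford :=
  EvenClifford (cl_rev_even (even_valP x)).

Lemma even_rev_linear (a : R) (x y : even_clifford) :
  even_rev (a *: x + y) = a *: even_rev x + even_rev y.
Proof. by apply: val_inj; apply: cl_rev_linear. Qed.

Lemma even_rev1 : even_rev 1 = 1.
Proof. by apply: val_inj; apply: cl_rev1. Qed.

Lemma even_revK : involutive even_rev.
Proof. by move=> x; apply: val_inj; apply: cl_revK. Qed.

Lemma even_revM (x y : even_clifford) : even_rev (x * y) = even_rev y * even_rev x.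
Proof. by apply: val_inj; apply: cl_revM. Qed.

End CliffordAlgebra.

Arguments even_clifford {R n} q.

Definition invertible (A : nzRingType) (a : A) : Prop :=
  exists b : A, a * b = 1 /\ b * a = 1.

(* The indices 0, 1, 2, 3, 4 stand for the generators e_1, e_2, e_3, e_+, e_-. *)
Definition cga_sqr (R : realType) (i : 'I_5) : R := if i == ord_max then -1 else 1.

Definition CGAp (R : realType) : Type := even_clifford (@cga_sqr R).

HB.instance Definition _ (R : realType) := GRing.Algebra.on (CGAp R).

Section MotionPolynomials.
Variable R : realType.
Implicit Types (C : {poly CGAp R}) (h : CGAp R).

Definition rev_poly C : {poly CGAp R} := map_poly (@even_rev _ _ _) C.

Definition motion_poly C : Prop :=
  C * rev_poly C = rev_poly C * C /\
  exists2 p : {poly R}, p != 0 & C * rev_poly C = map_poly (in_alg (CGAp R)) p.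

Definition norm_quad h : {poly CGAp R} := ('X - h%:P) * ('X - (even_rev h)%:P).

(* For monic M, [rmodp P M] is the unique R with P = Q * M + R and
   size R < size M. *)
Definition linear_remainder_lead (P M : {poly CGAp R}) : CGAp R :=
  (Pdiv.CommonRing.rmodp P M)`_1.

Definition irregular (hs : seq (CGAp R)) : Prop :=
  exists2 l : nat, (l < size hs)%N &
    let M := norm_quad hs`_l in
    ~ invertible
        (linear_remainder_lead (\prod_(h <- take l.+1 hs) ('X - h%:P)) M) \/
    ~ invertible
        (linear_remainder_lead (\prod_(h <- drop l hs) ('X - h%:P)) M).

End MotionPolynomials.

(* Main.v *)
Require Import Defs.
From mathcomp Require Import all_boot all_order all_algebra.
From mathcomp Require Import reals.

Import GRing.Theory.
Local Open Scope ring_scope.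

(**
   The remainder of (t - h_1)(t - h_2) by the norm polynomial of h_1 has leading
   coefficient rev h_1 - h_2, its remainder by the norm polynomial of h_2 has
   rev h_2 - h_1, and t - h_l is its own remainder. Up to sign the first two
   coefficients are exchanged by reversion, which preserves invertibility.
*)

Lemma invertible1 (A : nzRingType) : invertible (1 : A).
Proof. by exists 1; rewrite mulr1. Qed.

Lemma invertibleN (A : nzRingType) (a : A) : invertible a -> invertible (- a).
Proof. by case=> b [ab ba]; exists (- b); rewrite !mulrNN. Qed.

Lemma even_revB (R : comNzRingType) n (q : 'I_n -> R) (x y : even_clifford q) :
  even_rev (x - y) = even_rev x - even_rev y.
Proof. by rewrite addrC -scaleN1r even_rev_linear scaleN1r addrC. Qed.

(** An anti-automorphism swaps left and right inverses, so two-sided inverses go to two-sided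
    inverses. *)
Lemma invertible_rev (R : comNzRingType) n (q : 'I_n -> R)
    (x : even_clifford q) : invertible x -> invertible (even_rev x).
Proof.
by case=> y [xy yx]; exists (even_rev y); rewrite -!even_revM xy yx even_rev1.
Qed.

Lemma mul_XsubC2 (A : nzRingType) (a b : A) :
  ('X - a%:P) * ('X - b%:P) = 'X^2 - (a + b) *: 'X + (a * b)%:P.
Proof.
rewrite mulrBl !mulrBr -expr2 -commr_polyX -polyCM opprB !mul_polyC.
by rewrite addrACA addrC [RHS]addrAC [RHS]addrC scalerDl opprD [- _ - _ in RHS]addrC.
Qed.

(** Monic factors make degrees add even when [A] has zero divisors. *)
Lemma size_mul_XsubC2 (A : nzRingType) (a b : A) :
  size (('X - a%:P) * ('X - b%:P)) = 3%N.
Proof.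
by rewrite size_Mmonic ?monicXsubC ?monic_neq0 ?monicXsubC // !size_XsubC.
Qed.

Lemma lead_remainder_XsubC (A : nzRingType) (a c d : A) :
  (Pdiv.CommonRing.rmodp ('X - a%:P) (('X - c%:P) * ('X - d%:P)))`_1 = 1.
Proof.
rewrite Pdiv.CommonRing.rmodp_small ?size_mul_XsubC2 ?size_XsubC //.
by rewrite coefB coefX coefC subr0.
Qed.

(** Both products are monic quadratics, so the quotient is 1 and the remainder is their
    difference. *)
Lemma lead_remainder_XsubC2 (A : nzRingType) (a b c d : A) :
  (Pdiv.CommonRing.rmodp (('X - a%:P) * ('X - b%:P))
     (('X - c%:P) * ('X - d%:P)))`_1 = (c + d) - (a + b).
Proof.
set M := _ * ('X - d%:P).
have M_monic : M \is monic by rewrite monicMl monicXsubC.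
pose r := ((c + d) - (a + b)) *: 'X + (a * b - c * d)%:P.
have -> : ('X - a%:P) * ('X - b%:P) = 1 * M + r.
  rewrite mul1r /M /r !mul_XsubC2 scalerBl polyCB addrACA subrKA.
  by rewrite [_%:P + (_ - _)]addrC subrK.
(* Division by the monic [M] is unique, so it remains to bound the degree of [r] by 1. *)
rewrite Pdiv.RingMonic.rmodp_addl_mul_small //.
  by rewrite coefD coefZ coefX coefC mulr1 addr0.
rewrite size_mul_XsubC2 ltnS (leq_trans (size_polyD _ _)) // geq_max.
rewrite (leq_trans (size_scale_leq _ _)) ?size_polyX //.
by rewrite (leq_trans (size_polyC_leq1 _)).
Qed.

Theorem theorem3p1 (R : realType) (C : {poly CGAp R}) (h1 h2 : CGAp R)
    (C_monic : C \is monic) (C_deg2 : size C = 3%N) (C_motion : motion_poly C)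
    (h1_motion : motion_poly ('X - h1%:P)) (h2_motion : motion_poly ('X - h2%:P))
    (C_fact : C = ('X - h1%:P) * ('X - h2%:P)) :
  irregular [:: h1; h2] <-> ~ invertible (h1 - even_rev h2).
Proof.
split=> [[[|[|//]] _] /= | ninv].
(* Indices start at 0. Here the prefix is the single factor of [h1], and the suffix is the whole
   product, with coefficient the reverse of [h1 - even_rev h2]. *)
- rewrite !big_cons !big_nil !mulr1 /linear_remainder_lead /norm_quad.
  rewrite lead_remainder_XsubC lead_remainder_XsubC2.
  case=> [[]|ninv inv]; first exact: invertible1.
  apply: ninv; have /invertible_rev := inv.
  by rewrite even_revB even_revK opprD addrACA subrr add0r.
(* Now the prefix is the whole product and the suffix the single factor of [h2]. *)
- rewrite !big_cons !big_nil !mulr1 /linear_remainder_lead /norm_quad.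
  rewrite lead_remainder_XsubC lead_remainder_XsubC2.
  case=> [ninv inv|[]]; last exact: invertible1.
  apply: ninv; have /invertibleN := inv.
  by rewrite opprB [h1 + h2]addrC opprD addrACA subrr add0r.
(* Dividing by the norm polynomial of [h2] gives [h1 - even_rev h2] up to sign, without a
   reversion. *)
exists 1%N => //=; left.
rewrite !big_cons !big_nil !mulr1 /linear_remainder_lead /norm_quad.
rewrite lead_remainder_XsubC2 [h1 + h2]addrC opprD addrACA subrr add0r => inv.
by apply: ninv; have := invertibleN _ _ inv; rewrite opprB.
Qed.
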